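(* Let $X_1,X_2,\ldots$ be independent real random variables with common probability density $f$ such that $f\in L^2(\mathbb{R})$ and $f$ has a weak second derivative $f''\in L^2(\mathbb{R})$. Let $K:\mathbb{R}\to\mathbb{R}$ satisfy $K\in L^1(\mathbb{R})\cap L^2(\mathbb{R})$, $\int K(u)\,du=1$, $\int uK(u)\,du=0$, $\int u^2|K(u)|\,du<\infty$. Suppose $\mu_2(K)^2R(f'')>0$. Let $\widehat R_n$ be a nonnegative estimator of $R(f'')$ (a nonnegative random variable for each $n$) such that $$\frac{\widehat R_n}{R(f'')}\xrightarrow{p}1 .$$ On the event $\{\widehat R_n>0\}$ define $$\widehat h_n=\left\{\frac{R(K)}{\mu_2(K)^2\,\widehat R_n\,n}\right\}^{1/5},$$ and on the event $\{\widehat R_n=0\}$ define $\widehat h_n=h_{\operatorname{AMISE}}$. Then $$\frac{\widehat h_n}{h_{\operatorname{AMISE}}}\xrightarrow{p}1\qquad\text{and}\qquad \frac{\operatorname{AMISE}(\widehat f_{\widehat h_n})}{\operatorname{AMISE}(\widehat f_{h_{\operatorname{AMISE}}})}\xrightarrow{p}1 .$$ Moreover, the same two conclusions hold with $\widehat h_n$ replaced by the truncated bandwidth $$\widehat h_{\operatorname{GCPI}}=\left\{\frac{R(K)}{\mu_2(K)^2\,\widehat R_{b,\tau}\,n}\right\}^{1/5},\qquad \widehat R_{b,\tau}=\max\{\widehat R_b^{U},\tau_n\},$$ whenever $\widehat R_b^{U}/R(f'')\xrightarrow{p}1$ and $\tau_n/R(f'')\to0$.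
   Context: Notation: $\mu_2(K)=\int_{\mathbb{R}}u^2K(u)\,du$; $R(g)=\int_{\mathbb{R}}g(x)^2\,dx$; $\xrightarrow{p}$ is convergence in probability as $n\to\infty$. A function $g\in L^1_{\mathrm{loc}}(\mathbb{R})$ is the weak second derivative of $f$, written $g=f''$, if $\int g\varphi\,dx=\int f\varphi''\,dx$ for every smooth compactly supported $\varphi$. For $h>0$ and sample size $n$, $\operatorname{AMISE}(\widehat f_h)=\frac{h^4}{4}\mu_2(K)^2R(f'')+\frac{R(K)}{nh}$, regarded as a function of $h$ into which a (possibly random) bandwidth may be substituted; its minimizer over $h>0$ is $h_{\operatorname{AMISE}}=\left(\frac{R(K)}{\mu_2(K)^2R(f'')\,n}\right)^{1/5}$. Pilot estimator: $L:\mathbb{R}\to\mathbb{R}$ is a pilot kernel with $L\in L^1(\mathbb{R})$, $\int L(u)\,du=1$, whose weak second derivative satisfies $L''\in L^1(\mathbb{R})\cap L^2(\mathbb{R})$; $b=b_n>0$ is a deterministic pilot bandwidth; $G_L(z)=\int_{\mathbb{R}}L''(y)L''(y+z)\,dy$; and, for $n\ge2$, $$\widehat R_b^{U}=\frac{1}{n(n-1)b^5}\sum_{1\le i\ne j\le n}G_L\left(\frac{X_i-X_j}{b}\right).$$ The truncation level $\tau_n>0$ is deterministic with $\tau_n\downarrow0$. *)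

(* Defs.v *)
From HB Require Import structures.
From mathcomp Require Import all_boot all_order all_algebra.
From mathcomp Require Import finmap.
From mathcomp Require Import all_classical all_reals all_analysis.

Set Implicit Arguments.
Unset Strict Implicit.
Unset Printing Implicit Defensive.

Import Order.TTheory GRing.Theory Num.Theory.
Import numFieldNormedType.Exports.

Local Open Scope classical_set_scope.
Local Open Scope ring_scope.

Section real_functions.
Context {R : realType}.
Implicit Types (f g phi K L : R -> R).

Definition roughness g : R := \int[lebesgue_measure]_x (g x ^+ 2).

Definition mu2 K : R := \int[lebesgue_measure]_u (u ^+ 2 * K u).

Definition test_function phi :=
  (forall (k : nat) (x : R), derivable (derive1n k phi) x 1) /\
  compact (closure [set x | phi x != 0]).

Definition weak_second_derivative f g :=
  locally_integrable setT g /\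
  forall phi, test_function phi ->
    \int[lebesgue_measure]_x (g x * phi x) =
    \int[lebesgue_measure]_x (f x * derive1n 2 phi x).

(* [r] stands for the (true or estimated) roughness of [f'']. *)
Definition bandwidth K (r : R) (n : nat) : R :=
  (roughness K / (mu2 K ^+ 2 * r * n%:R)) `^ (5^-1).

Definition h_amise K (f2 : R -> R) (n : nat) : R :=
  bandwidth K (roughness f2) n.

Definition amise K (f2 : R -> R) (n : nat) (h : R) : R :=
  h ^+ 4 / 4 * mu2 K ^+ 2 * roughness f2 + roughness K / (n%:R * h).

Definition plugin_bandwidth K (f2 : R -> R) (n : nat) (r : R) : R :=
  if 0 < r then bandwidth K r n else h_amise K f2 n.

Definition autocorrelation g (z : R) : R :=
  \int[lebesgue_measure]_y (g y * g (y + z)).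

End real_functions.

Section probability_notions.
Context {d : measure_display} {T : measurableType d} {R : realType}.
Variable P : probability T R.

Definition mutually_independent (X : nat -> T -> R) :=
  forall (S : {fset nat}) (A : nat -> set R),
    (forall i, measurable (A i)) ->
    P (\bigcap_(i in [set` S]) X i @^-1` A i) =
    (\prod_(i <- S) P (X i @^-1` A i))%E.

Definition has_density (X : T -> R) (f : R -> R) :=
  [/\ measurable_fun setT f,
      forall x, 0 <= f x &
      forall A : set R, measurable A ->
        P (X @^-1` A) = (\int[lebesgue_measure]_(x in A) (f x)%:E)%E].

Definition cvg_in_probability (Y : nat -> T -> R) (c : R) :=
  forall eps : R, 0 < eps ->
    P [set w | eps < `|Y n w - c|] @[n --> \oo] --> 0%E.

(* [L2] is the weak second derivative of the pilot kernel; the sample of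
   size [n] is [X 0, ..., X n.-1]. The value is meaningful for [1 < n]. *)
Definition pilot_estimator (L2 : R -> R) (b : nat -> R) (X : nat -> T -> R)
    (n : nat) (w : T) : R :=
  (n%:R * (n%:R - 1) * b n ^+ 5)^-1 *
  \sum_(i < n) \sum_(j < n | i != j)
     autocorrelation L2 ((X i w - X j w) / b n).

End probability_notions.

(* Main.v *)
Require Import Defs.
From HB Require Import structures.
From mathcomp Require Import all_boot all_order all_algebra.
From mathcomp Require Import all_classical all_reals all_analysis.
From mathcomp Require Import measurable_realfun ring lra.
Import Order.TTheory GRing.Theory Num.Theory.
Import numFieldNormedType.Exports.
Local Open Scope classical_set_scope.
Local Open Scope ring_scope.

(** The theorem is scale invariance followed by continuous mapping.

Write [h0] for [h_amise] and [Y] for the estimated roughness divided by the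
true one. Since [roughness K > 0], the bandwidth formula is homogeneous of
degree [-1/5] in the roughness, so the ratio of the plug-in bandwidth to [h0]
is [plugin_factor Y], where [plugin_factor x = x^(-1/5)] for [x > 0]
([plugin_bandwidth_div]). Next, [h0^5] is the ratio of the variance and bias
coefficients of AMISE, so that in units of [h0] the two terms of AMISE combine
into [AMISE (t h0) / AMISE (h0) = (t^4 + 4/t) / 5], which is [amise_factor t]
([amise_div]). Neither function depends on [n], and both are continuous at [1]
with value [1], so both conclusions follow from [Y -> 1] in probability by
[cvg_in_probability_comp]; this is [plugin_bandwidth_consistent].

The truncated pilot estimator is positive everywhere, hence is itself a plug-in
estimator, and truncating does no harm: once the truncation level falls below
the true roughness, taking the maximum can only bring the estimate closer to
the truth ([cvg_in_probability_max]).

Two points of measure theory remain. A probability is monotone on measurable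
sets only, so the pilot estimator must be shown to be a random variable; this
rests on the measurability of the autocorrelation of the pilot kernel, a
consequence of Tonelli's theorem ([measurable_autocorrelation]). And
[roughness K > 0] holds because a kernel that vanishes almost everywhere cannot
have integral one ([roughness_gt0]). *)

(** * Convergence in probability *)

Lemma measurable_deviation d (T : measurableType d) (R : realType)
    (Z : T -> R) (c eps : R) :
  measurable_fun setT Z -> measurable [set w | eps < `|Z w - c|].
Proof.
move=> mZ.
have -> : [set w | eps < `|Z w - c|] =
    [set: T] `&` (fun w => `|Z w - c|) @^-1` `]eps, +oo[%classic.
  by rewrite setTI; apply/seteqP; split => w /=; rewrite in_itv /= andbT.
have mf : measurable_fun setT (fun w => `|Z w - c|).
  apply: measurableT_comp => //.
  by apply: measurable_funB.
by apply: mf => //; exact: measurable_itv.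
Qed.

Section convergence_in_probability.
Context d (T : measurableType d) (R : realType) (P : probability T R).
Implicit Types (Y Z : nat -> T -> R).

(** The comparison behind every transfer of convergence below: each large
deviation of [Z] forces one of [Y], so its probability is squeezed to zero.
Measurability of [Z n] is asked only for large [n] because [Z n] will be known
explicitly only there: bandwidth formulas degenerate at [n = 0]. *)
Lemma cvg_in_probability_le Y Z (a c : R) :
  (forall n, measurable_fun setT (Y n)) ->
  (\forall n \near \oo, measurable_fun setT (Z n)) ->
  (forall eps, 0 < eps -> exists2 delta, 0 < delta &
     \forall n \near \oo, forall w,
       eps < `|Z n w - c| -> delta < `|Y n w - a|) ->
  cvg_in_probability P Y a -> cvg_in_probability P Z c.
Proof.
move=> mY mZ YZ Ya eps eps0.
have [delta delta0 near_le] := YZ _ eps0.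
apply: (squeeze_cvge _ (cvg_cst 0%E) (Ya _ delta0)).
near=> n.
rewrite measure_ge0 /=; apply: le_measure; rewrite ?inE.
- by apply: measurable_deviation; apply: (near mZ n).
- exact: measurable_deviation.
- by move=> w /=; apply: (near near_le n).
Unshelve. all: by end_near. Qed.

(** The continuous mapping theorem at a constant limit, with [g] continuous at
that constant only. *)
Lemma cvg_in_probability_comp Y Z (c : R) (g : R -> R) :
  (forall n, measurable_fun setT (Y n)) ->
  measurable_fun setT g ->
  {for c, continuous g} ->
  (\forall n \near \oo, forall w, Z n w = g (Y n w)) ->
  cvg_in_probability P Y c -> cvg_in_probability P Z (g c).
Proof.
move=> mY mg cg Zg; apply: cvg_in_probability_le => //.
  near=> n; have -> : Z n = g \o Y n by apply/funext; apply: (near Zg n).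
  exact: measurableT_comp.
move=> eps eps0.
have /cvgrPdist_le/(_ _ eps0) := cg.
(* Balls are open while deviations beyond a threshold are strict, hence the
   halved radius. *)
move=> /nbhs_ballP[delta /= delta0 gd].
exists (delta / 2); first by rewrite divr_gt0.
near=> n => w.
have -> : Z n w = g (Y n w) by apply: (near Zg n).
rewrite 2!ltNge; apply: contra => Yc.
rewrite distrC; apply: gd; rewrite /ball /= distrC.
by apply: (le_lt_trans Yc); lra.
Unshelve. all: by end_near. Qed.

(** If [u <= c] then [y |-> max y u] fixes [c] and is 1-Lipschitz, so truncating
[Y n] from below at such a level does not increase its distance to [c]. *)
Lemma cvg_in_probability_max Y (u : nat -> R) (c : R) :
  (forall n, measurable_fun setT (Y n)) ->
  (\forall n \near \oo, u n <= c) ->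
  cvg_in_probability P Y c ->
  cvg_in_probability P (fun n w => Num.max (Y n w) (u n)) c.
Proof.
move=> mY uc; apply: cvg_in_probability_le => //.
  by apply: nearW => n; apply: measurable_maxr.
move=> eps eps0; exists eps => //; near=> n => w.
have un : u n <= c by apply: (near uc n).
move=> /lt_le_trans; apply.
case: (leP (Y n w) (u n)) => // Yu.
rewrite ler0_norm ?subr_le0// ler0_norm ?subr_le0 ?(le_trans Yu)//.
by rewrite lerN2 lerD2r.
Unshelve. all: by end_near. Qed.
End convergence_in_probability.

(** * Measurability of the pilot estimator *)

(** Tonelli's theorem applied to the positive and the negative part of
[(z, y) |-> g y * g (y + z)]. For each sign the integral over [y] may be
infinite at some [z], but as an extended-real function of [z] it is measurable,
and so is the difference of the two. *)
Lemma measurable_autocorrelation (R : realType) (g : R -> R) :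
  measurable_fun setT g -> measurable_fun setT (autocorrelation g).
Proof.
move=> mg.
pose F (p : R * R) : \bar R := (g p.2 * g (p.2 + p.1))%:E.
have mF : measurable_fun [set: R * R] F.
  apply/measurable_EFinP; apply: measurable_funM.
    by apply: measurableT_comp.
  by apply: measurableT_comp => //; apply: measurable_funD.
rewrite /autocorrelation /Rintegral.
apply: (measurableT_comp (f := fine)); first exact: fine_measurable.
under eq_fun do rewrite integralE.
apply: emeasurable_funB.
- rewrite (_ : (fun z => _) = fubini_F (@lebesgue_measure R) (F^\+)%E).
    apply: measurable_fun_fubini_tonelli_F; first exact: measurable_funepos.
    by move=> x; exact: funepos_ge0.
  by apply/funext => z; apply: eq_integral => y _; rewrite !funeposE.
- rewrite (_ : (fun z => _) = fubini_F (@lebesgue_measure R) (F^\-)%E).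
    apply: measurable_fun_fubini_tonelli_F; first exact: measurable_funeneg.
    by move=> x; exact: funeneg_ge0.
  by apply/funext => z; apply: eq_integral => y _; rewrite !funenegE.
Qed.

Lemma measurable_pilot_estimator d (T : measurableType d) (R : realType)
    (L2 : R -> R) (b : nat -> R) (X : nat -> T -> R) n :
  measurable_fun setT L2 -> (forall i, measurable_fun setT (X i)) ->
  measurable_fun setT (pilot_estimator L2 b X n).
Proof.
move=> mL mX; rewrite /pilot_estimator.
apply: measurable_funM => //; apply: measurable_sum => i.
under eq_fun => w do rewrite -big_filter.
apply: measurable_sum => j.
apply: measurableT_comp; first exact: measurable_autocorrelation.
by apply: measurable_funM => //; apply: measurable_funB.
Qed.

(** * Bandwidths and AMISE relative to the optimal bandwidth *)

(** Square integrability makes the integral of [K^2] finite, so the real number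
[roughness K] vanishes only if that integral does; then [K = 0] almost
everywhere, against the hypothesis on its integral. *)
Lemma roughness_gt0 (R : realType) (K : R -> R) :
  K \in Lfun lebesgue_measure 2%:E ->
  \int[lebesgue_measure]_u K u != 0 -> 0 < roughness K.
Proof.
move=> K2 K0.
have mK : measurable_fun setT K by move/andP: K2 => [/set_mem].
have iK := Lfun2_integrable_sqr K2.
rewrite lt_neqAle eq_sym Rintegral_ge0 ?andbT; last by move=> *; exact: sqr_ge0.
apply: contra K0 => /eqP RK0.
have mK2 : measurable_fun setT (fun x => (K x ^+ 2)%:E).
  by apply/measurable_EFinP; exact: measurable_funX.
have /(ae_eq_integral_abs lebesgue_measure measurableT mK2) K2ae :
    (\int[lebesgue_measure]_x `|(K x ^+ 2)%:E| = 0)%E.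
  under eq_integral => x _ do rewrite gee0_abs ?lee_fin ?sqr_ge0//.
  rewrite -[LHS]fineK; first by congr EFin.
  exact: integrable_fin_num.
have Kae : ae_eq lebesgue_measure setT (EFin \o K) (cst 0%E).
  apply: filterS K2ae => x /= + xT => /(_ xT)[] /eqP.
  by rewrite sqrf_eq0 => /eqP ->.
rewrite /Rintegral (ae_eq_integral _ _ _ _ _ Kae)//; first by rewrite integral0.
exact/measurable_EFinP.
Qed.

Section bandwidths.
Context {R : realType}.
Implicit Types K : R -> R.

(** The value [1] for [x <= 0] reflects the convention that the plug-in
bandwidth is the optimal one when the estimated roughness is not positive. *)
Definition plugin_factor (x : R) : R := if 0 < x then x `^ (- 5^-1) else 1.

(** The power [t `^ (- 1)] agrees with [t^-1] for [t >= 0]; written this way the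
measurability and continuity of real powers apply. *)
Definition amise_factor (t : R) : R := (t ^+ 4 + 4 * t `^ (- 1)) / 5.

Lemma plugin_factor1 : plugin_factor 1 = 1.
Proof. by rewrite /plugin_factor ltr01 powR1. Qed.

Lemma amise_factor1 : amise_factor 1 = 1.
Proof. by rewrite /amise_factor powR1 expr1n; lra. Qed.

Lemma measurable_plugin_factor : measurable_fun setT plugin_factor.
Proof.
by apply: measurable_fun_ifT => //; exact: measurable_fun_ltr.
Qed.

Lemma measurable_amise_factor : measurable_fun setT amise_factor.
Proof.
rewrite /amise_factor; apply: measurable_funM => //.
apply: measurable_funD; first exact: measurable_funX.
by apply: measurable_funM => //; exact: (measurable_powR (- 1)).
Qed.

Lemma powR_continuous_at (a x : R) : 0 < x ->
  {for x, continuous (@powR R ^~ a)}.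
Proof.
move=> x0; apply: differentiable_continuous; apply/derivable1_diffP.
by apply: derivable_powR; rewrite in_itv /= x0.
Qed.

Lemma plugin_factor_continuous1 : {for 1, continuous plugin_factor}.
Proof.
have := @powR_continuous_at (- 5^-1) 1 ltr01.
rewrite /prop_for /continuous_at plugin_factor1 powR1; apply: cvg_trans.
apply: near_eq_cvg; near=> x; rewrite /plugin_factor ifT//.
near: x; exact: lt_nbhsr.
Unshelve. all: by end_near. Qed.

Lemma amise_factor_continuous1 : {for 1, continuous amise_factor}.
Proof.
rewrite /prop_for /continuous_at /amise_factor.
apply: cvgM; last exact: cvg_cst.
apply: cvgD; first exact: exprn_continuous.
by apply: cvgM; [exact: cvg_cst|exact: powR_continuous_at].
Qed.

Lemma bandwidthX5_gt0 K (r : R) n : 0 < roughness K -> mu2 K != 0 -> 0 < r ->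
  (0 < n)%N -> 0 < roughness K / (mu2 K ^+ 2 * r * n%:R).
Proof.
move=> K0 m0 r0 n0; have m2 : 0 < mu2 K ^+ 2 by rewrite exprn_even_gt0.
apply: divr_gt0 => //; apply: mulr_gt0; last by rewrite ltr0n.
exact: mulr_gt0.
Qed.

Lemma bandwidth_gt0 K (r : R) n : 0 < roughness K -> mu2 K != 0 -> 0 < r ->
  (0 < n)%N -> 0 < bandwidth K r n.
Proof. by move=> *; apply: powR_gt0; exact: bandwidthX5_gt0. Qed.

Lemma bandwidth_div K (r s : R) n : 0 < roughness K -> mu2 K != 0 -> 0 < r ->
  0 < s -> (0 < n)%N ->
  bandwidth K r n / bandwidth K s n = (r / s) `^ (- 5^-1).
Proof.
move=> K0 m0 r0 s0 n0.
have hs0 : 0 < bandwidth K s n by exact: bandwidth_gt0.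
rewrite powRN; apply: (canLR (mulfK (lt0r_neq0 hs0))).
apply: (canRL (mulKf _)); first by rewrite lt0r_neq0// powR_gt0// divr_gt0.
rewrite /bandwidth -powRM; last 2 first.
- by rewrite divr_ge0// ltW.
- by rewrite ltW// bandwidthX5_gt0.
congr (_ `^ _); field.
by rewrite m0 !gt_eqF// ltr0n.
Qed.

Lemma plugin_bandwidth_div K f2 (r : R) n : 0 < roughness K -> mu2 K != 0 ->
  0 < roughness f2 -> (0 < n)%N ->
  plugin_bandwidth K f2 n r / h_amise K f2 n = plugin_factor (r / roughness f2).
Proof.
move=> K0 m0 f0 n0; rewrite /plugin_bandwidth /plugin_factor /h_amise.
rewrite (pmulr_lgt0 _ (_ : 0 < (roughness f2)^-1)) ?invr_gt0//.
case: ifP => r0; first exact: bandwidth_div.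
by rewrite divff// gt_eqF// bandwidth_gt0.
Qed.

(** Equivalently [roughness K / n = s^5 * mu2 K ^+ 2 * roughness f2] for
[s = h_amise K f2 n]: this is the first-order condition for the minimum of
AMISE, and what makes the variance term at [s] four times the bias term. *)
Lemma h_amiseX5 K f2 n : 0 < roughness K -> mu2 K != 0 ->
  0 < roughness f2 -> (0 < n)%N ->
  h_amise K f2 n ^+ 5 = roughness K / (mu2 K ^+ 2 * roughness f2 * n%:R).
Proof.
move=> K0 m0 f0 n0; rewrite -powR_mulrn ?powR_ge0// /h_amise /bandwidth.
rewrite -powRrM mulVf// powRr1// ltW//.
exact: bandwidthX5_gt0.
Qed.

(** With [s = h_amise K f2 n], [h_amiseX5] makes AMISE at [u * s] equal to
[u^4 + 4/u] times a factor that does not depend on [u]; for [u = 1] the sum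
[u^4 + 4/u] is [5]. The identity persists at [h = 0]
because [0^-1 = 0] on both sides. *)
Lemma amise_div K f2 (h : R) n : 0 < roughness K -> mu2 K != 0 ->
  0 < roughness f2 -> (0 < n)%N -> 0 <= h ->
  amise K f2 n h / amise K f2 n (h_amise K f2 n) =
  amise_factor (h / h_amise K f2 n).
Proof.
move=> K0 m0 f0 n0 h0.
have hs0 : 0 < h_amise K f2 n by exact: bandwidth_gt0.
have := h_amiseX5 _ _ _ K0 m0 f0 n0; move: hs0.
set s := h_amise K f2 n => hs0 s5.
rewrite /amise_factor powR_inv1 ?divr_ge0 ?(ltW hs0)//.
set t := h / s; have -> : h = t * s by rewrite /t divfK// gt_eqF.
have n0' : (n%:R : R) != 0 by rewrite pnatr_eq0 -lt0n.
have KE : roughness K = s ^+ 5 * (mu2 K ^+ 2 * roughness f2 * n%:R).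
  by rewrite s5 divfK// !mulf_neq0// ?expf_neq0// gt_eqF.
have amiseE (u : R) : amise K f2 n (u * s) =
    s ^+ 4 * (mu2 K ^+ 2 * roughness f2) / 4 * (u ^+ 4 + 4 * u^-1).
  rewrite /amise KE invfM (invfM u s).
  (* Generalizing the inverse keeps the identity polynomial in it, so that the
     case [u = 0] is covered too. *)
  by move: (u^-1) => v; field; rewrite n0' gt_eqF.
have amise_s : amise K f2 n s = amise K f2 n (1 * s) by rewrite mul1r.
rewrite amise_s !amiseE invr1 expr1n mulr1.
by move: (t^-1) => v; field; rewrite m0 !gt_eqF.
Qed.

End bandwidths.

(** * Consistency of plug-in bandwidths *)

(** Both ratios are fixed functions of [r n w / roughness f2] as soon as
[0 < n]: [plugin_factor] for the bandwidth, and [amise_factor \o plugin_factor]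
for AMISE. *)
Lemma plugin_bandwidth_consistent d (T : measurableType d) (R : realType)
    (P : probability T R) (K f2 : R -> R) (r : nat -> T -> R) :
  0 < roughness K -> mu2 K != 0 -> 0 < roughness f2 ->
  (forall n, measurable_fun setT (r n)) ->
  cvg_in_probability P (fun n w => r n w / roughness f2) 1 ->
  let h := fun n w => plugin_bandwidth K f2 n (r n w) in
  cvg_in_probability P (fun n w => h n w / h_amise K f2 n) 1 /\
  cvg_in_probability P
    (fun n w => amise K f2 n (h n w) / amise K f2 n (h_amise K f2 n)) 1.
Proof.
move=> K0 m0 f0 mr r1 h.
have ratioE : \forall n \near \oo, forall w,
    h n w / h_amise K f2 n = plugin_factor (r n w / roughness f2).
  near=> n => w; apply: plugin_bandwidth_div => //.
  by near: n; exact: nbhs_infty_gt.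
have mY n : measurable_fun setT (fun w => r n w / roughness f2).
  exact: measurable_funM.
split.
  rewrite -plugin_factor1; apply: cvg_in_probability_comp r1 => //.
    exact: measurable_plugin_factor.
  exact: plugin_factor_continuous1.
rewrite -amise_factor1 -plugin_factor1.
apply: (cvg_in_probability_comp _ _ _ _ _ _ _
  (amise_factor \o plugin_factor)) r1 => //.
- apply: measurableT_comp; first exact: measurable_amise_factor.
  exact: measurable_plugin_factor.
- apply: continuous_comp; first exact: plugin_factor_continuous1.
  rewrite plugin_factor1; exact: amise_factor_continuous1.
- near=> n => w /=.
  have <- : h n w / h_amise K f2 n = plugin_factor (r n w / roughness f2).
    by apply: (near ratioE n).
  apply: amise_div => //; first by near: n; exact: nbhs_infty_gt.
  by rewrite /h /plugin_bandwidth; case: ifP => _; exact: powR_ge0.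
Unshelve. all: by end_near. Qed.

Theorem theorem5p2 (R : realType) (d : measure_display) (T : measurableType d)
  (P : probability T R) (X : nat -> {RV P >-> R}) (f f2 K : R -> R)
  (X_indep : mutually_independent P X)
  (X_density : forall i, has_density P (X i) f)
  (f_L2 : f \in Lfun lebesgue_measure 2%:E)
  (f2_weak : weak_second_derivative f f2)
  (f2_L2 : f2 \in Lfun lebesgue_measure 2%:E)
  (K_L1 : K \in Lfun lebesgue_measure 1%:E)
  (K_L2 : K \in Lfun lebesgue_measure 2%:E)
  (K_mass : \int[lebesgue_measure]_u K u = 1)
  (K_mean : \int[lebesgue_measure]_u (u * K u) = 0)
  (K_moment2 : (\int[lebesgue_measure]_u (u ^+ 2 * `|K u|)%:E < +oo)%E)
  (curvature_pos : 0 < mu2 K ^+ 2 * roughness f2) :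
  (forall Rhat : nat -> {RV P >-> R},
     (forall n w, 0 <= Rhat n w) ->
     cvg_in_probability P (fun n w => Rhat n w / roughness f2) 1 ->
     let hhat := fun n w => plugin_bandwidth K f2 n (Rhat n w) in
     cvg_in_probability P (fun n w => hhat n w / h_amise K f2 n) 1 /\
     cvg_in_probability P
       (fun n w => amise K f2 n (hhat n w) / amise K f2 n (h_amise K f2 n)) 1)
  /\
  (forall (L L2 : R -> R) (b tau : nat -> R),
     L \in Lfun lebesgue_measure 1%:E ->
     \int[lebesgue_measure]_u L u = 1 ->
     weak_second_derivative L L2 ->
     L2 \in Lfun lebesgue_measure 1%:E ->
     L2 \in Lfun lebesgue_measure 2%:E ->
     (forall n, 0 < b n) ->
     (forall n, 0 < tau n) ->
     nonincreasing_seq tau ->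
     tau n @[n --> \oo] --> 0 ->
     cvg_in_probability P
       (fun n w => pilot_estimator L2 b X n w / roughness f2) 1 ->
     tau n / roughness f2 @[n --> \oo] --> 0 ->
     let hgcpi := fun n w =>
       bandwidth K (Num.max (pilot_estimator L2 b X n w) (tau n)) n in
     cvg_in_probability P (fun n w => hgcpi n w / h_amise K f2 n) 1 /\
     cvg_in_probability P
       (fun n w => amise K f2 n (hgcpi n w) / amise K f2 n (h_amise K f2 n))
       1).
Proof.
have K0 : 0 < roughness K by apply: roughness_gt0; rewrite // K_mass oner_neq0.
have m0 : mu2 K != 0.
  by apply: contraTneq curvature_pos => ->; rewrite expr0n mul0r ltxx.
have f0 : 0 < roughness f2.
  by move: curvature_pos; rewrite pmulr_rgt0// exprn_even_gt0.
split=> [Rhat _ Rhat1|L L2 b tau _ _ _ L2_L1 _ _ tau0 _ _ Rb1 tau_ratio0].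
  by apply: plugin_bandwidth_consistent.
move=> hgcpi.
have mL2 : measurable_fun setT L2 by move/andP: L2_L1 => [/set_mem].
have mRb n : measurable_fun setT (pilot_estimator L2 b X n).
  exact: measurable_pilot_estimator.
(* The truncated estimator is positive, so the default branch of the plug-in
   bandwidth is never taken. *)
have hgcpiE : hgcpi = fun n w => plugin_bandwidth K f2 n
    (Num.max (pilot_estimator L2 b X n w) (tau n)).
  apply/funext => n; apply/funext => w; rewrite /plugin_bandwidth ifT//.
  by rewrite lt_max tau0 orbT.
rewrite hgcpiE; apply: plugin_bandwidth_consistent => //.
  by move=> n; apply: measurable_maxr.
rewrite (_ : (fun n w => _ / _) = fun n w =>
    Num.max (pilot_estimator L2 b X n w / roughness f2) (tau n / roughness f2)).
  apply: cvg_in_probability_max => //.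
    by move=> n; apply: measurable_funM.
  near=> n; apply: ltW; near: n.
  exact: (cvgr_lt 0).
apply/funext => n; apply/funext => w.
by rewrite maxr_pMl// invr_ge0 ltW.
Unshelve. all: by end_near. Qed.
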